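(* The moments for the discrete big $q$-Hermite polynomials are $$\mathcal L^{(0)}(x^n)=\sum_{k=0}^{\lfloor n/2\rfloor}\begin{bmatrix}n\\2k\end{bmatrix}_q(q;q^2)_k\,y^{n-2k},$$ $$\mathcal L^{(1)}(x^n)=(1-q^n)\sum_{k=0}^{\lfloor n/2\rfloor}\begin{bmatrix}n-1\\2k\end{bmatrix}_q(q;q^2)_k\,y^{n-2k-1}.$$
   Context: $n\ge0$ is an integer, $q$ is a fixed number with $0<|q|<1$ and $y$ is a parameter. $(z;p)_n=\prod_{i=0}^{n-1}(1-zp^i)$, $(z;p)_\infty=\prod_{i\ge0}(1-zp^i)$, $(z)_n=(z;q)_n$ for $n$ finite or $\infty$. $\begin{bmatrix}n\\k\end{bmatrix}_q=\frac{(q)_n}{(q)_k(q)_{n-k}}$, which is taken to be $0$ if $k<0$ or $k>n$ (in which case the corresponding term of the sum is $0$). The discrete big $q$-Hermite I polynomials $h_n=h_n(x,y;q)$ are defined by the formal power series identity in $t$ $$\sum_{n=0}^\infty h_n(x,y;q)\frac{t^n}{(q;q)_n}=\frac{(t^2;q^2)_\infty(yt)_\infty}{(xt)_\infty};$$ $h_n$ is monic of degree $n$ in $x$. For $i\in\{0,1\}$, $\mathcal L^{(i)}$ is the linear functional on polynomials in $x$ determined by $\mathcal L^{(i)}(h_m(x,y;q))=\delta_{m,i}$ for all $m\ge0$.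
   Formalization: The second formula is proved with prefactor (1-q^n)/(1-q) instead of the printed (1-q^n), which is false: h_0=1 and h_1=x-y give L^(1)(x)=1, whereas the printed right-hand side at n=1 is 1-q. *)

(* Defs.v *)
From HB Require Import structures.
From mathcomp Require Import all_boot all_order all_algebra.
From mathcomp Require Export complex.
From mathcomp Require Import all_classical all_reals all_analysis.

Set Implicit Arguments.
Unset Strict Implicit.
Unset Printing Implicit Defensive.
Import Order.TTheory GRing.Theory Num.Theory.
Import numFieldNormedType.Exports.
Local Open Scope classical_set_scope.
Local Open Scope ring_scope.
Local Open Scope complex_scope.

(* (z; p)_n in an arbitrary ring; used both for scalars and, with z a
   polynomial in the formal variable t, for the partial products of the
   generating function. *)
Definition qpoch (A : comNzRingType) (z p : A) (n : nat) : A :=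
  \prod_(i < n) (1 - z * p ^+ i).

(* Natural-number indices: the only case k < 0 or n < 0 of the general
   convention that the moment formulas meet is [-1, 0]_q, which occurs there
   with the factor 1 - q ^+ 0 = 0. *)
Definition qbinom (K : fieldType) (q : K) (n k : nat) : K :=
  if (k <= n)%N then qpoch q q n / (qpoch q q k * qpoch q q (n - k)) else 0.

(* A formal power series in t is its sequence of coefficients. *)
Definition fps_mul (A : nzRingType) (a b : nat -> A) (n : nat) : A :=
  \sum_(i < n.+1) a i * b (n - i)%N.

(* (z; p)_oo as a formal power series in t ('X plays the role of t): each
   coefficient is the limit of the corresponding coefficients of the partial
   products.  R[i] carries its topology only through the alias (R[i])^o. *)
Definition qpoch_infty (R : realType) (z : {poly R[i]}) (p : R[i])
    (n : nat) : R[i] :=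
  lim ((fun N => (qpoch z p%:P N)`_n : (R[i])^o) @ \oo).

(* Generating function of the discrete big q-Hermite I polynomials, as an
   identity of formal power series in t for every complex value of x:
     sum_n h_n(x) t^n / (q)_n = (t^2; q^2)_oo (y t)_oo / (x t)_oo.
   The denominator has constant coefficient 1, hence is invertible, and is
   moved to the left-hand side. *)
Definition discrete_big_qHermite (R : realType) (q y : R[i])
    (h : nat -> {poly R[i]}) : Prop :=
  forall x : R[i],
    fps_mul (fun n => (h n).[x] / qpoch q q n) (qpoch_infty (x *: 'X) q) =1
    fps_mul (qpoch_infty 'X^2 (q ^+ 2)) (qpoch_infty (y *: 'X) q).

(* The linear functional L^(i); {scalar {poly R[i]}} is the type of linear
   forms.  Since h_0 = 1 and h_1 = x - y, this normalization forces
   L^(1)(x) = 1. *)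
Definition dual_functional (R : realType) (h : nat -> {poly R[i]}) (i : nat)
    (L : {scalar {poly R[i]}}) : Prop :=
  forall m : nat, L (h m) = (m == i)%:R.

(* Main.v *)
Require Import Defs.
From mathcomp Require Import all_boot all_order all_algebra.
From mathcomp Require Import all_classical all_reals all_analysis.
From mathcomp Require Import ring.

Set Implicit Arguments.
Unset Strict Implicit.
Unset Printing Implicit Defensive.
Import Order.TTheory GRing.Theory Num.Theory.
Import numFieldNormedType.Exports.
Local Open Scope ring_scope.
Local Open Scope complex_scope.

(** The generating function identity can be read backwards.  With
[G(t) = 1 / ((t^2; q^2)_oo (y t)_oo)] it says
[1 / (x t)_oo = G(t) \sum_n h_n(x) t^n / (q)_n].  By Euler's expansion
[1 / (x t)_oo = \sum_n x^n t^n / (q)_n] ([small_big_qexp]), comparing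
coefficients of [t^n] expands [x^n] on the polynomials [h_k]
([Xn_qHermite]).  The functional dual to [h_i] picks the coefficient of
[h_i], so its [n]-th moment is [(q)_n / (q)_i] times the coefficient of
[t^(n-i)] in [G] ([dual_functional_Xn]).  Expanding both factors of [G] by
Euler's formula and using [(q)_(2k) = (q; q^2)_k (q^2; q^2)_k]
([qpoch_double]) gives the sum over [k] ([qpoch_moment_fps]).

The infinite products are defined coefficientwise as limits of finite
products.  The coefficients of the finite products satisfy a first-order
recursion that depends on the number [N] of factors only through [q ^+ N]
([coefS_qpochX]); since [q ^+ N] tends to [0], the limits exist and are the
coefficients of Euler's second series ([coef_qpochX_cvg]). *)

(** * Formal power series *)

Definition fps_one (A : nzRingType) (n : nat) : A := (n == 0%N)%:R.

(** The coefficients of [a] with [t] replaced by [t ^ d]. *)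
Definition fps_stretch (A : nzRingType) (d : nat) (a : nat -> A) (n : nat) : A :=
  if (d %| n)%N then a (n %/ d)%N else 0.

(** Only finitely many coefficients enter the [n]-th coefficient of a product,
so series may be replaced by polynomials that agree with them up to [n].
The ring laws for series are transferred from [{poly A}] in this way. *)
Lemma fps_mul_coefM (A : comNzRingType) (a b : nat -> A) (r s : {poly A}) n :
  (forall i, (i <= n)%N -> r`_i = a i) ->
  (forall i, (i <= n)%N -> s`_i = b i) ->
  fps_mul a b n = (r * s)`_n.
Proof.
move=> ra sb; rewrite coefM; apply: eq_bigr => i _.
by rewrite ra ?sb ?leq_subr // -ltnS.
Qed.

Lemma coef_trunc (A : nzRingType) (a : nat -> A) n i :
  (i <= n)%N -> (\poly_(j < n.+1) a j)`_i = a i.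
Proof. by move=> le_in; rewrite coef_poly ltnS le_in. Qed.

Lemma fps_mulC (A : comNzRingType) (a b : nat -> A) :
  fps_mul a b = fps_mul b a.
Proof.
apply/funext => n.
rewrite (fps_mul_coefM (@coef_trunc _ a n) (@coef_trunc _ b n)) mulrC.
by rewrite -(fps_mul_coefM (@coef_trunc _ b n) (@coef_trunc _ a n)).
Qed.

Lemma fps_mulA (A : comNzRingType) (a b c : nat -> A) :
  fps_mul a (fps_mul b c) = fps_mul (fps_mul a b) c.
Proof.
apply/funext => n.
have tr_mul (u v : nat -> A) i : (i <= n)%N ->
    (\poly_(j < n.+1) u j * \poly_(j < n.+1) v j)`_i = fps_mul u v i.
  move=> le_in; rewrite -(fps_mul_coefM (a := u) (b := v)) // => j le_ji;
    by rewrite coef_trunc // (leq_trans le_ji).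
rewrite (fps_mul_coefM (@coef_trunc _ a n) (tr_mul b c)) mulrA.
by rewrite -(fps_mul_coefM (tr_mul a b) (@coef_trunc _ c n)).
Qed.

Lemma fps_mul1r (A : comNzRingType) (a : nat -> A) : fps_mul a (fps_one A) = a.
Proof.
apply/funext => n; rewrite /fps_mul big_ord_recr /= subnn mulr1 big1 ?add0r //.
by move=> i _; rewrite /fps_one subn_eq0 leqNgt ltn_ord mulr0.
Qed.

Lemma fps_stretch_one (A : nzRingType) d :
  (0 < d)%N -> fps_stretch d (fps_one A) = fps_one A.
Proof.
move=> d_gt0; apply/funext => n; rewrite /fps_stretch /fps_one.
case: ifPn => [/dvdnP[k ->]|nd].
  by rewrite mulnK // muln_eq0 (gtn_eqF d_gt0) orbF.
by case: eqP nd => // ->; rewrite dvdn0.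
Qed.

(** Substituting [t ^ d] for [t] is composition with ['X^d], a ring
morphism. *)
Lemma fps_stretchM (A : comNzRingType) d (a b : nat -> A) :
  (0 < d)%N ->
  fps_mul (fps_stretch d a) (fps_stretch d b) = fps_stretch d (fps_mul a b).
Proof.
move=> d_gt0; apply/funext => n.
have tr (u : nat -> A) i : (i <= n)%N ->
    ((\poly_(j < n.+1) u j) \Po 'X^d)`_i = fps_stretch d u i.
  move=> le_in; rewrite coef_comp_poly_Xn // /fps_stretch.
  by case: ifP => // _; rewrite coef_trunc // (leq_trans (leq_div _ _)).
rewrite (fps_mul_coefM (tr a) (tr b)) -comp_polyM coef_comp_poly_Xn //.
rewrite /fps_stretch; case: ifP => // _; rewrite -(fps_mul_coefM (a := a) (b := b)) // => i le_i;
  by rewrite coef_trunc // (leq_trans le_i) // leq_div.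
Qed.

Lemma sum_even_odd (V : nmodType) (F : nat -> V) m :
  \sum_(0 <= i < m.*2) F i = \sum_(0 <= k < m) (F k.*2 + F k.*2.+1).
Proof.
elim: m => [|m IHm]; first by rewrite !big_geq.
by rewrite doubleS !big_nat_recr //= IHm addrA.
Qed.

(** Only the even indices of the stretched factor contribute. *)
Lemma fps_mul_stretch2 (A : nzRingType) (a b : nat -> A) n :
  fps_mul (fps_stretch 2 a) b n =
  \sum_(0 <= k < (n./2).+1) a k * b (n - k.*2)%N.
Proof.
pose F i := fps_stretch 2 a i * b (n - i)%N.
have FE : \sum_(0 <= i < (n./2).+1.*2) F i =
          \sum_(0 <= k < (n./2).+1) a k * b (n - k.*2)%N.
  rewrite sum_even_odd; apply: eq_bigr => k _.
  rewrite /F /fps_stretch !dvdn2 /= !odd_double /= mul0r addr0.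
  by rewrite -muln2 mulnK.
rewrite -FE /fps_mul -(big_mkord xpredT F).
have := odd_double_half n; case: (boolP (odd n)) => odd_n nE.
  by have -> : ((n./2).+1.*2 = n.+1)%N by rewrite doubleS -{2}nE.
(* For even n the pairing of indices adds the odd index n + 1. *)
have -> : ((n./2).+1.*2 = n.+2)%N by rewrite doubleS -{2}nE.
rewrite [RHS]big_nat_recr //=.
by rewrite [F n.+1]/F /fps_stretch dvdn2 /= odd_n mul0r addr0.
Qed.

(** * Euler's q-exponential series *)

Lemma qpochS (A : comNzRingType) (z p : A) n :
  qpoch z p n.+1 = qpoch z p n * (1 - z * p ^+ n).
Proof. by rewrite /qpoch big_ord_recr. Qed.

Lemma qpoch0 (A : comNzRingType) (z p : A) : qpoch z p 0 = 1.
Proof. by rewrite /qpoch big_ord0. Qed.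

Lemma qpoch_neq0 (K : fieldType) (p : K) n :
  (forall m, 1 - p ^+ m.+1 != 0) -> qpoch p p n != 0.
Proof. by move=> p_nu; apply/prodf_neq0 => i _; rewrite -exprS. Qed.

(** The even and the odd powers of [q] are separated. *)
Lemma qpoch_double (A : comNzRingType) (q : A) k :
  qpoch q q k.*2 = qpoch q (q ^+ 2) k * qpoch (q ^+ 2) (q ^+ 2) k.
Proof.
elim: k => [|k IHk]; first by rewrite !qpoch0 mulr1.
rewrite doubleS !qpochS IHk -!exprM -!exprS -exprD mul2n add2n; ring.
Qed.

(** The coefficients of [1 / (a t; p)_oo], Euler's small q-exponential of
[a t]. *)
Definition small_qexp (K : fieldType) (a p : K) (n : nat) : K :=
  a ^+ n / qpoch p p n.

(** The coefficients of [(a t; p)_oo], Euler's big q-exponential of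
[- a t]. *)
Definition big_qexp (K : fieldType) (a p : K) (n : nat) : K :=
  (- a) ^+ n * p ^+ 'C(n, 2) / qpoch p p n.

Lemma small_qexpS (K : fieldType) (a p : K) n :
  (forall m, 1 - p ^+ m.+1 != 0) ->
  (1 - p ^+ n.+1) * small_qexp a p n.+1 = a * small_qexp a p n.
Proof.
move=> p_nu; rewrite /small_qexp qpochS.
have := qpoch_neq0 n p_nu; have := p_nu n; rewrite !exprS => u v.
by field; apply/andP.
Qed.

Lemma big_qexpS (K : fieldType) (a p : K) n :
  (forall m, 1 - p ^+ m.+1 != 0) ->
  (1 - p ^+ n.+1) * big_qexp a p n.+1 = - (a * p ^+ n * big_qexp a p n).
Proof.
move=> p_nu; rewrite /big_qexp qpochS binS bin1 exprD.
have := qpoch_neq0 n p_nu; have := p_nu n; rewrite !exprS => u v.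
by field; apply/andP.
Qed.

(** The recursions for the two series say [f(p t) = (1 - a t) f(t)] and
[e(t) = (1 - a t) e(p t)], so [f e] is invariant under [t -> p t]; as
[p ^+ n] differs from [1] for positive [n], it is constant. *)
Lemma small_big_qexp (K : fieldType) (a p : K) :
  (forall m, 1 - p ^+ m.+1 != 0) ->
  fps_mul (small_qexp a p) (big_qexp a p) = fps_one K.
Proof.
move=> p_nu; apply/funext => -[|m].
  by rewrite /fps_mul big_ord1 /small_qexp /big_qexp !qpoch0 !expr0 !divr1 !mulr1.
set f := small_qexp a p; set e := big_qexp a p.
apply: (mulfI (p_nu m)); rewrite [fps_one _ _]mulr0n mulr0 /fps_mul mulr_sumr.
(* f(t) e(t) - f(pt) e(pt) = (f(t) - f(pt)) e(pt) + f(t) (e(t) - e(pt)) *)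
transitivity (\sum_(i < m.+2)
    ((1 - p ^+ i) * f i * (p ^+ (m.+1 - i) * e (m.+1 - i)%N) +
     f i * ((1 - p ^+ (m.+1 - i)) * e (m.+1 - i)%N))).
  apply: eq_bigr => i _.
  by rewrite -{1}(subnKC (ltn_ord i : (i <= m.+1)%N)) exprD; ring.
(* The two recursions make the first sum, shifted by one, opposite to the
   second one. *)
rewrite big_split /= big_ord_recl /= expr0 subrr !mul0r add0r.
rewrite [X in _ + X]big_ord_recr /= subnn expr0 subrr mul0r mulr0 addr0.
rewrite -big_split big1 // => i _ /=.
rewrite /bump /= add1n subSS small_qexpS // subSn -1?ltnS // big_qexpS //.
by rewrite -/f -/e; ring.
Qed.

Lemma coef0_qpochX (A : comNzRingType) (a p : A) N :
  (qpoch (a *: 'X) p%:P N)`_0 = 1.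
Proof.
elim: N => [|N IHN]; first by rewrite qpoch0 coef1.
rewrite qpochS coefM big_ord1 IHN -rmorphXn coefB coef1 coefMC coefZ coefX.
by rewrite mulr0 mul0r subr0 mulr1.
Qed.

(** The recursion behind the q-binomial theorem.  The partial product
[P_N(t)] of [(a t; p)_oo] satisfies both [P_(N+1)(t) = P_N(t) (1 - a p^N t)]
and [P_(N+1)(t) = (1 - a t) P_N(p t)]; comparing coefficients eliminates
[P_(N+1)].  Since [N] then enters only through [p ^+ N], convergence of the
coefficients follows by induction on their index. *)
Lemma coefS_qpochX (A : comNzRingType) (a p : A) N n :
  (1 - p ^+ n.+1) * (qpoch (a *: 'X) p%:P N)`_n.+1 =
  a * (p ^+ N - p ^+ n) * (qpoch (a *: 'X) p%:P N)`_n.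
Proof.
have coefSS M m : (qpoch (a *: 'X) p%:P M.+1)`_m.+1 =
    (qpoch (a *: 'X) p%:P M)`_m.+1 - a * p ^+ M * (qpoch (a *: 'X) p%:P M)`_m.
  rewrite qpochS -rmorphXn mulrBr mulr1 coefB; congr (_ - _).
  by rewrite mulrA -scalerAr coefMC coefZ coefMX /= mulrAC.
elim: N n => [|N IHN] [|n].
- by rewrite !qpoch0 !coef1 /= subrr !mulr0 mul0r.
- by rewrite !qpoch0 !coef1 /= !mulr0.
- by rewrite coefSS mulrBr IHN !coef0_qpochX !exprS !expr0; ring.
- rewrite !coefSS mulrBr IHN.
  have := IHN n.
  move: (_`_n) (_`_n.+1) => u v; rewrite !exprS => vE.
  have -> : a * (p * p ^+ N - p * p ^+ n) * (v - a * p ^+ N * u) =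
      a * (p * p ^+ N - p * p ^+ n) * v -
      a * p * p ^+ N * (a * (p ^+ N - p ^+ n) * u) by ring.
  by rewrite -vE; ring.
Qed.

(** * Infinite products in the complex field *)

Lemma expr_cvg0 (R : realType) (q : R[i]) : `|q| < 1 ->
  ((fun n => q ^+ n : (R[i])^o) @ \oo --> (0 : (R[i])^o))%classic.
Proof.
rewrite normc_def; set r := Num.sqrt _ => r_lt1.
have r_lt1' : `|r| < 1 by rewrite ger0_norm ?sqrtr_ge0 // -ltcR.
have /cvgr0Pnorm_lt cvg_r := cvg_expr r_lt1'.
apply/cvgr0Pnorm_lt => eps eps_gt0.
(* A positive complex number is real, so the claim reduces to the real
   geometric sequence of ratio the modulus of q. *)
have epsE : eps = (complex.Re eps)%:C.
  by move: eps_gt0; rewrite ltcE /=; case: eps => u v /= /andP[/eqP ->].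
have e_gt0 : 0 < complex.Re eps by rewrite -ltcR -epsE.
near=> n.
have : `|r ^+ n| < complex.Re eps by near: n; apply: cvg_r.
rewrite normrX ger0_norm ?sqrtr_ge0 // => rn_lt.
have -> : `|q ^+ n : (R[i])^o| = (r ^+ n)%:C.
  by rewrite [LHS](normrX n (q : R[i])) normc_def -/r rmorphXn.
by rewrite epsE ltcR.
Unshelve. all: by end_near. Qed.

Lemma one_sub_expr_neq0 (R : realType) (q : R[i]) : `|q| < 1 ->
  forall m, 1 - q ^+ m.+1 != 0.
Proof.
move=> q_lt1 m; rewrite subr_eq0; apply: contraTneq q_lt1 => /(congr1 Num.norm).
rewrite normr1 normrX => /esym/eqP.
by rewrite pexprn_eq1 ?normr_ge0 //= => /eqP ->; rewrite ltxx.
Qed.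

Lemma coef_qpochX_cvg (R : realType) (a q : R[i]) n : `|q| < 1 ->
  ((fun N => (qpoch (a *: 'X) q%:P N)`_n : (R[i])^o) @ \oo -->
    (big_qexp a q n : (R[i])^o))%classic.
Proof.
move=> q_lt1; have q_nu := one_sub_expr_neq0 q_lt1.
elim: n => [|n IHn].
  rewrite /big_qexp qpoch0 !expr0 divr1 mulr1.
  under eq_fun do rewrite coef0_qpochX.
  exact: cvg_cst.
pose c := a / (1 - q ^+ n.+1).
have -> : big_qexp a q n.+1 = c * (0 - q ^+ n) * big_qexp a q n.
  apply: (mulfI (q_nu n)); rewrite big_qexpS // /c.
  by field.
have -> : (fun N => (qpoch (a *: 'X) q%:P N)`_n.+1) =
    (fun N => c * (q ^+ N - q ^+ n) * (qpoch (a *: 'X) q%:P N)`_n).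
  apply/funext => N; apply: (mulfI (q_nu n)); rewrite coefS_qpochX /c.
  by field.
apply: (@cvgM (R[i])^o _ _ _ _ _ _ _ _ IHn).
apply: (@cvgM (R[i])^o); first exact: cvg_cst.
apply: (@cvgB _ (R[i])^o); last exact: cvg_cst.
exact: expr_cvg0.
Qed.

Lemma qpoch_inftyX (R : realType) (a q : R[i]) : `|q| < 1 ->
  qpoch_infty (a *: 'X) q = big_qexp a q.
Proof.
move=> q_lt1; apply/funext => n; rewrite /qpoch_infty.
exact: (cvg_lim (@norm_hausdorff _ (R[i])^o) (@coef_qpochX_cvg _ a q n q_lt1)).
Qed.

Lemma qpoch_inftyXn (R : realType) (q : R[i]) d : (0 < d)%N -> `|q| < 1 ->
  qpoch_infty 'X^d q = fps_stretch d (big_qexp 1 q).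
Proof.
move=> d_gt0 q_lt1; apply/funext => n.
have coefE N : (qpoch 'X^d q%:P N)`_n =
    fps_stretch d (fun i => (qpoch (1 *: 'X) q%:P N)`_i) n.
  have -> : qpoch 'X^d q%:P N = qpoch (1 *: 'X) q%:P N \Po 'X^d.
    rewrite /qpoch rmorph_prod; apply: eq_bigr => i _.
    rewrite -rmorphXn scale1r -polyC1 /= comp_polyB comp_polyM comp_polyX.
    by rewrite !comp_polyC.
  by rewrite coef_comp_poly_Xn.
rewrite /qpoch_infty; under eq_fun do rewrite coefE.
rewrite /fps_stretch; case: ifP => _; last exact: (@lim_cst (R[i])^o).
exact: (congr1 (fun s => s _) (qpoch_inftyX 1 q_lt1)).
Qed.

(** * Moments *)

Lemma poly_eq_horner (F : numFieldType) (r s : {poly F}) :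
  (forall x, r.[x] = s.[x]) -> r = s.
Proof.
move=> rs; apply/eqP; rewrite -subr_eq0; apply/eqP.
pose xs : seq F := [seq i%:R | i <- iota 0 (size (r - s)%R)].
apply: (@roots_geq_poly_eq0 _ _ xs).
- by apply/allP => x _; rewrite /root hornerD hornerN rs subrr.
- by rewrite map_inj_uniq ?iota_uniq // => i j /eqP; rewrite eqr_nat => /eqP.
- by rewrite size_map size_iota.
Qed.

(** The coefficients of [1 / ((t^2; q^2)_oo (y t)_oo)], which, up to the
factors [(q)_n], generates the moments. *)
Definition moment_fps (K : fieldType) (q y : K) : nat -> K :=
  fps_mul (fps_stretch 2 (small_qexp 1 (q ^+ 2))) (small_qexp y q).

(** Dividing the generating function by [(t^2; q^2)_oo (y t)_oo] leaves
[1 / (x t)_oo], whose coefficients are [x ^+ n / (q)_n]. *)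
Lemma Xn_qHermite (R : realType) (q y : R[i]) (h : nat -> {poly R[i]}) n :
  `|q| < 1 -> discrete_big_qHermite q y h ->
  'X^n = \sum_(k < n.+1)
    (qpoch q q n / qpoch q q k * moment_fps q y (n - k)) *: h k.
Proof.
move=> q_lt1 hH; have q_nu := one_sub_expr_neq0 q_lt1.
have q2_lt1 : `|q ^+ 2| < 1 by rewrite normrX exprn_ilt1.
have q2_nu := one_sub_expr_neq0 q2_lt1.
apply: poly_eq_horner => x; rewrite hornerXn horner_sum.
have := funext (hH x); rewrite !qpoch_inftyX // qpoch_inftyXn //.
set H := (fun n => _); set T := fps_stretch _ _; set Y := big_qexp y q.
set X := big_qexp x q => HX.
pose T' := fps_stretch 2 (small_qexp 1 (q ^+ 2)); pose Y' := small_qexp y q.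
have TT' : fps_mul T T' = fps_one _.
  by rewrite fps_stretchM // fps_mulC small_big_qexp // fps_stretch_one.
have YY' : fps_mul Y Y' = fps_one _ by rewrite fps_mulC small_big_qexp.
have GE : fps_mul (fps_mul T Y) (moment_fps q y) = fps_one _.
  rewrite /moment_fps -/T' -/Y' [fps_mul T' _]fps_mulC fps_mulA.
  by rewrite -(fps_mulA T) YY' fps_mul1r TT'.
have key : fps_mul H (moment_fps q y) = small_qexp x q.
  rewrite -[RHS]fps_mul1r -GE -HX (fps_mulA (small_qexp x q)).
  congr fps_mul.
  by rewrite (fps_mulC H) fps_mulA small_big_qexp // fps_mulC fps_mul1r.
have -> : x ^+ n = qpoch q q n * small_qexp x q n.
  by rewrite /small_qexp mulrC divfK ?qpoch_neq0.
rewrite -key /fps_mul mulr_sumr; apply: eq_bigr => k _.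
rewrite hornerZ /H; ring.
Qed.

Lemma dual_functional_Xn (R : realType) (q y : R[i]) (h : nat -> {poly R[i]})
    (L : {scalar {poly R[i]}}) i n :
  `|q| < 1 -> discrete_big_qHermite q y h -> dual_functional h i L ->
  (i <= n)%N ->
  L 'X^n = qpoch q q n / qpoch q q i * moment_fps q y (n - i).
Proof.
move=> q_lt1 hH hL le_in; rewrite (Xn_qHermite n q_lt1 hH) linear_sum.
rewrite (bigD1 (Ordinal (le_in : (i < n.+1)%N))) //= big1 ?addr0.
  by rewrite linearZ /= hL eqxx mulr1.
by move=> k; rewrite -val_eqE /= linearZ /= hL => /negPf ->; rewrite mulr0.
Qed.

Lemma qpoch_moment_fps (K : fieldType) (q y : K) n :
  (forall m, 1 - q ^+ m.+1 != 0) ->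
  qpoch q q n * moment_fps q y n =
  \sum_(0 <= k < (n./2).+1)
    qbinom q n k.*2 * qpoch q (q ^+ 2) k * y ^+ (n - k.*2).
Proof.
move=> q_nu; rewrite /moment_fps fps_mul_stretch2 mulr_sumr.
apply: eq_big_nat => k /andP[_]; rewrite ltnS => le_k.
have le_2k : (k.*2 <= n)%N by rewrite -geq_half_double.
rewrite /qbinom le_2k /small_qexp expr1n qpoch_double.
have : qpoch q q k.*2 != 0 by exact: qpoch_neq0.
rewrite qpoch_double mulf_eq0 => /norP[A0 B0].
have C0 : qpoch q q (n - k.*2) != 0 by exact: qpoch_neq0.
by field; apply/and3P.
Qed.

Theorem theorem4p4 (R : realType) (q y : R[i])
    (q_gt0 : 0 < `|q|) (q_lt1 : `|q| < 1)
    (h : nat -> {poly R[i]}) (hH : discrete_big_qHermite q y h)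
    (L0 L1 : {scalar {poly R[i]}})
    (hL0 : dual_functional h 0 L0) (hL1 : dual_functional h 1 L1)
    (n : nat) :
  L0 'X^n =
    \sum_(0 <= k < (n./2).+1)
      qbinom q n k.*2 * qpoch q (q ^+ 2) k * y ^+ (n - k.*2)
  /\
  L1 'X^n =
    (1 - q ^+ n) / (1 - q) *
    \sum_(0 <= k < (n./2).+1)
      qbinom q n.-1 k.*2 * qpoch q (q ^+ 2) k * y ^+ (n - k.*2 - 1).
Proof.
have q_nu := one_sub_expr_neq0 q_lt1.
split.
  rewrite (dual_functional_Xn q_lt1 hH hL0) // qpoch0 divr1 subn0.
  exact: qpoch_moment_fps.
case: n => [|n].
  rewrite (Xn_qHermite 0 q_lt1 hH) big_ord1 linearZ /= hL1 mulr0.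
  by rewrite expr0 subrr !mul0r.
have q1_neq0 : 1 - q != 0 by have := q_nu 0%N; rewrite expr1.
rewrite (dual_functional_Xn q_lt1 hH hL1) // subn1 /= !qpochS qpoch0.
have -> : qpoch q q n * (1 - q * q ^+ n) / (1 * (1 - q * q ^+ 0)) *
    moment_fps q y n =
    (1 - q ^+ n.+1) / (1 - q) * (qpoch q q n * moment_fps q y n).
  by rewrite exprS expr0; field.
rewrite qpoch_moment_fps //; congr (_ * _).
have -> : \sum_(0 <= k < ((n.+1)./2).+1)
      qbinom q n k.*2 * qpoch q (q ^+ 2) k * y ^+ (n.+1 - k.*2 - 1) =
    \sum_(0 <= k < ((n.+1)./2).+1)
      qbinom q n k.*2 * qpoch q (q ^+ 2) k * y ^+ (n - k.*2).
  by apply: eq_bigr => k _; rewrite subnAC subn1.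
rewrite -uphalfE uphalf_half.
(* For odd n the range contains the extra index 2k = n + 1, at which the
   q-binomial coefficient [n, 2k] is zero by convention. *)
case: (boolP (odd n)) => odd_n; last by rewrite add0n.
rewrite add1n [RHS]big_nat_recr //=.
have lt_n : (n < (n./2).+1.*2)%N.
  by rewrite doubleS -{1}(odd_double_half n) odd_n.
by rewrite {3}/qbinom leqNgt lt_n /= !mul0r addr0.
Qed.
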